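(* Let $\Lambda$ be an indecomposable, non-hereditary, symmetric $R$-order in $\mathcal A$ and $\Gamma:=\mathrm{Id}(J(\Lambda))$. Let $\epsilon_1,\dots,\epsilon_s$ be the central primitive idempotents of $\mathcal A$ and let $e_1,\dots,e_h\in\Lambda$ be orthogonal lifts of the central primitive idempotents of $\Lambda/J(\Lambda)$, ordered so that $e_i\Lambda e_i/J(e_i\Lambda e_i)\cong e_i\Gamma e_i/J(e_i\Gamma e_i)$ for $1\le i\le t$ and $J(e_i\Gamma e_i)=J(e_i\Lambda e_i)$ for $t<i\le h$. Put $f:=\sum_{i=t+1}^h e_i$. Assume that $f=0$ and that $\Delta:=\mathrm{Id}(J(\Gamma))$ is hereditary. Then: (i) $J(\Lambda)^2\epsilon_i\subseteq\Lambda$ for all $1\le i\le s$. In particular $\pi^2\epsilon_i\in\Lambda$ for all $i$, i.e. the defect of $\Lambda$ is at most $2$. (ii) $\epsilon_i e_l\Lambda e_j\subseteq e_l\Lambda e_j$ for all $1\le i\le s$ and all $1\le l\ne j\le h$. (iii) If $s>1$, then $\epsilon_iJ(\Lambda)\not\subseteq J(\Lambda)$ for all $1\le i\le s$.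
   Context: $R$ is a discrete valuation ring with maximal ideal $\pi R$, residue field $k=R/\pi R$ and field of fractions $K$; $\mathcal A$ is a separable finite dimensional $K$-algebra. An $R$-order in $\mathcal A$ is a subring containing $1_{\mathcal A}$ that is a full $R$-lattice in $\mathcal A$. $J(\cdot)$ is the Jacobson radical. An order is hereditary if each of its left ideals is projective; it is indecomposable if it is not a direct sum of two nonzero two-sided ideals. For a full $R$-lattice $L$ in $\mathcal A$, $\mathrm{Id}(L)=\{a\in\mathcal A: aL\subseteq L,\ La\subseteq L\}$. For $z\in Z(\mathcal A)^*$ let $\mathrm{Tr}_z(a,b)=\mathrm{tr}_{red}(zab)$ with $\mathrm{tr}_{red}:\mathcal A\to K$ the reduced trace; an $R$-order $\Lambda$ is symmetric if, for some such $z$, $\Lambda=\Lambda^{\#}:=\{a\in\mathcal A:\mathrm{Tr}_z(\Lambda,a)\subseteq R\}$. For each $i$ exactly one of the two alternatives used for the ordering of the $e_i$ holds (the isomorphism in the first alternative is as $e_i\Lambda e_i$-$e_i\Lambda e_i$-bimodules). The defect of $\Lambda$ is the minimal $d$ such that $\pi^d\epsilon_i\in\Lambda$ for all $1\le i\le s$. *)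

(* Defs.v *)
From HB Require Import structures.
From mathcomp Require Import all_boot all_order all_algebra all_field.
From mathcomp Require Import boolp classical_sets.

Set Implicit Arguments.
Unset Strict Implicit.
Unset Printing Implicit Defensive.

Import GRing.Theory.
Local Open Scope classical_set_scope.
Local Open Scope ring_scope.

Notation "x %:F" := (FracField.tofrac x) : ring_scope.

(* Subrings, ideals and lattices are subsets of an ambient ring T. A subring S
   may have an identity different from 1 : T, as the corner rings e S e do, so
   no definition in this section refers to 1. *)
Section Ideals.
Context {T : pzRingType}.
Implicit Types (S I J : set T) (x y e : T).

Definition left_ideal S I : Prop :=
  [/\ I `<=` S, I 0, forall x y, I x -> I y -> I (x - y)
    & forall a x, S a -> I x -> I (a * x)].

Definition two_sided_ideal S I : Prop :=
  left_ideal S I /\ (forall x a, I x -> S a -> I (x * a)).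

Definition maximal_left_ideal S M : Prop :=
  [/\ left_ideal S M, M <> S
    & forall I, left_ideal S I -> M `<=` I -> I = M \/ I = S].

Definition jacobson S : set T :=
  [set x | S x /\ forall M, maximal_left_ideal S M -> M x].

Definition ideal_mul I J : set T :=
  [set x | exists n (a b : 'I_n -> T),
     (forall k, I (a k) /\ J (b k)) /\ x = \sum_(k < n) a k * b k].

Definition peirce x S y : set T := [set x * a * y | a in S].

Definition indecomposable S : Prop :=
  ~ exists I J, [/\ two_sided_ideal S I, two_sided_ideal S J,
      I <> [set 0] /\ J <> [set 0], I `&` J = [set 0]
      & S = [set x + y | x in I & y in J]].

Definition idealizer S : set T :=
  [set a | (forall x, S x -> S (a * x)) /\ (forall x, S x -> S (x * a))].

(* Idempotents of the quotient ring S / J, for a two-sided ideal J of S, are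
   handled through representatives in S. *)
Definition central_idempotent_mod S J e : Prop :=
  [/\ S e, J (e * e - e) & forall a, S a -> J (e * a - a * e)].

Definition central_primitive_mod S J e : Prop :=
  [/\ central_idempotent_mod S J e, ~ J e
    & forall c d, central_idempotent_mod S J c ->
        central_idempotent_mod S J d ->
        J (c * d) -> J (e - (c + d)) -> J c \/ J d].

Definition central_primitive_idempotents s (eps : 'I_s -> T) : Prop :=
  injective eps /\
  forall x, central_primitive_mod setT [set 0] x <-> exists i, x = eps i.

Definition orthogonal_lifts S J h (e : 'I_h -> T) : Prop :=
  [/\ forall i, e i * e i = e i,
      forall i j, i != j -> e i * e j = 0,
      forall i, central_primitive_mod S J (e i)
    & forall c, central_primitive_mod S J c -> exists i, J (c - e i)].

(* M / N and M' / N' are isomorphic as S-S-bimodules; phi lifts the isomorphism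
   to representatives. *)
Definition quotient_bimodule_iso S (M N M' N' : set T) : Prop :=
  exists phi : T -> T,
  [/\ forall x, M x -> M' (phi x),
      forall x y, M x -> M y -> N' (phi (x + y) - (phi x + phi y)),
      forall a x, S a -> M x ->
        N' (phi (a * x) - a * phi x) /\ N' (phi (x * a) - phi x * a),
      forall x, M x -> (N' (phi x) <-> N x)
    & forall y, M' y -> exists2 x, M x & N' (y - phi x)].

End Ideals.

Section Hereditary.
Context {T : pzRingType}.

(* An S-module is a zmodType with an action of which only the restriction to S
   matters. *)
Definition is_left_module (S : set T) (M : zmodType) (act : T -> M -> M) :=
  [/\ forall m, act 1 m = m,
      forall a m n, S a -> act a (m + n) = act a m + act a n,
      forall a b m, S a -> S b -> act (a + b) m = act a m + act b m
    & forall a b m, S a -> S b -> act (a * b) m = act a (act b m)].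

Definition module_hom (S : set T) (M N : zmodType)
    (actM : T -> M -> M) (actN : T -> N -> N) (D : set M) (f : M -> N) :=
  (forall x y, D x -> D y -> f (x + y) = f x + f y) /\
  (forall a x, S a -> D x -> f (actM a x) = actN a (f x)).

Definition projective_left_ideal (S I : set T) : Prop :=
  forall (M N : zmodType) (actM : T -> M -> M) (actN : T -> N -> N),
  is_left_module S actM -> is_left_module S actN ->
  forall g : M -> N, module_hom S actM actN setT g ->
  (forall n, exists m, g m = n) ->
  forall f : T -> N, module_hom S *%R actN I f ->
  exists2 f' : T -> M, module_hom S *%R actM I f'
                     & forall x, I x -> g (f' x) = f x.

Definition hereditary (S : set T) : Prop :=
  forall I, left_ideal S I -> projective_left_ideal S I.

End Hereditary.

(* R is a principal ideal domain, not a field, with unique maximal ideal pi R. *)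
Definition dvr (R : idomainType) (pi : R) : Prop :=
  [/\ forall I : set R, left_ideal setT I ->
        exists a, I = [set r * a | r in setT],
      forall M : set R,
        maximal_left_ideal setT M <-> M = [set r * pi | r in setT]
    & pi != 0].

Definition semisimple (L : fieldType) (B : falgType L) : Prop :=
  forall U : {vspace B}, ({:B} * U <= U)%VS ->
  exists V : {vspace B},
    [/\ ({:B} * V <= V)%VS, (U + V = {:B})%VS & (U :&: V = 0)%VS].

(* B is L \otimes_K A, with j a = 1 \otimes a. *)
Definition scalar_extension (K L : fieldType) (iota : {rmorphism K -> L})
    (A : falgType K) (B : falgType L) (j : {rmorphism A -> B}) : Prop :=
  (forall c a, j (c *: a) = iota c *: j a) /\
  basis_of {:B} [seq j b | b <- vbasis {:A}].

Definition separable_algebra (K : fieldType) (A : falgType K) : Prop :=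
  forall (L : fieldType) (iota : {rmorphism K -> L}) (B : falgType L)
         (j : {rmorphism A -> B}),
  scalar_extension iota j -> semisimple B.

(* The phi i are the components of an isomorphism from L \otimes_K A onto the
   product of the matrix algebras of degrees (n i).+1 over L. The value tr a
   depends neither on L nor on this isomorphism. *)
Definition reduced_trace (K : fieldType) (A : falgType K) (tr : A -> K) :=
  exists (L : fieldType) (iota : {rmorphism K -> L}) (B : falgType L)
         (j : {rmorphism A -> B}),
  scalar_extension iota j /\
  exists (m : nat) (n : 'I_m -> nat)
         (phi : forall i, {lrmorphism B -> 'M[L]_((n i).+1)}),
  (forall M : forall i, 'M[L]_((n i).+1),
     exists! b : B, forall i, phi i b = M i) /\
  forall a, iota (tr a) = \sum_(i < m) \tr (phi i (j a)).

Section Orders.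
Context {R : idomainType} {A : falgType {fraction R}}.

Definition lattice_span (b : seq A) : set A :=
  [set x | exists c : 'I_(size b) -> R,
     x = \sum_(i < size b) (c i)%:F *: b`_i].

Definition full_lattice (L : set A) : Prop :=
  exists2 b : seq A, <<b>>%VS = {:A}%VS & L = lattice_span b.

Definition is_order (L : set A) : Prop :=
  [/\ full_lattice L, L 1 & forall x y, L x -> L y -> L (x * y)].

Definition trace_dual (tr : A -> {fraction R}) (z : A) (L : set A) : set A :=
  [set a | forall b, L b -> exists r : R, tr (z * b * a) = r%:F].

Definition symmetric_order (L : set A) : Prop :=
  exists z tr, [/\ z \in 'Z({:A})%VS, z \is a GRing.unit,
    reduced_trace tr & L = trace_dual tr z L].

Definition is_defect (pi : R) (L : set A) s (eps : 'I_s -> A) (d : nat) :=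
  (forall i, L ((pi ^+ d)%:F *: eps i)) /\
  forall d', (forall i, L ((pi ^+ d')%:F *: eps i)) -> (d <= d')%N.

End Orders.

(* Main.v *)
Require Import Defs.
From HB Require Import structures.
From mathcomp Require Import all_boot all_order all_algebra all_field.
From mathcomp Require Import boolp classical_sets.

Set Implicit Arguments.
Unset Strict Implicit.
Unset Printing Implicit Defensive.

Import GRing.Theory.
Local Open Scope classical_set_scope.
Local Open Scope ring_scope.

(** The Jacobson radical J of Lambda is an ideal of Gamma = Id(J), hence lies in
    J(Gamma). A hereditary order contains the central idempotents of the
    algebra: eps splits the surjection Delta -> Delta eps. So eps_i J is
    contained in J(Gamma), a subset of Gamma, and J J eps_i in J, which is (i).
    For l <> j, duality for the trace form gives e_l Gamma e_j = e_l Lambda e_j,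
    whence (ii). If eps_i J were contained in J, then eps_i would lie in Gamma;
    as f = 0, each e_l Gamma e_l is simple modulo its radical, so eps_i e_l is 0
    or e_l, and eps_i is a sum of some of the e_l, a nontrivial central
    idempotent of the indecomposable order Lambda. *)

(** * Subrings and the Jacobson radical *)

Section Subrings.
Context {T : pzRingType}.
Implicit Types (S I J L M : set T) (a b c d e x y : T).

(** The identity [e] is a parameter because corner rings e S e have an identity other than 1. *)
Definition subring_with S e : Prop :=
  [/\ S e, forall x y, S x -> S y -> S (x - y),
      forall x y, S x -> S y -> S (x * y)
    & forall x, S x -> e * x = x /\ x * e = x].

Section Jacobson.
Variables (S : set T) (e : T).
Hypothesis ringS : subring_with S e.

Let Se : S e. Proof. by case: ringS. Qed.
Let SB x y : S x -> S y -> S (x - y). Proof. by case: ringS => _ /(_ x y). Qed.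
Let SM x y : S x -> S y -> S (x * y). Proof. by case: ringS => _ _ /(_ x y). Qed.
Let Sel x : S x -> e * x = x. Proof. by case: ringS => _ _ _ h /h[]. Qed.
Let Ser x : S x -> x * e = x. Proof. by case: ringS => _ _ _ h /h[]. Qed.

Lemma subring_with0 : S 0.
Proof. by rewrite -(subrr e); apply: (SB). Qed.

Lemma subring_withN x : S x -> S (- x).
Proof. by rewrite -sub0r; apply: (SB); apply: subring_with0. Qed.

Lemma subring_withD x y : S x -> S y -> S (x + y).
Proof. by move=> Sx /subring_withN Sy; rewrite -[y]opprK; apply: (SB). Qed.

Lemma left_ideal_full I : left_ideal S I -> I e -> I = S.
Proof.
case=> IS _ _ IM Ie; apply/seteqP; split=> // x Sx.
by rewrite -(Ser Sx); apply: IM.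
Qed.

(** Zorn's lemma is applied to the sets [X] for which I ∪ X is a proper left ideal, so that the
    empty chain, whose union is empty, is covered by [I] itself. *)
Lemma sub_maximal_left_ideal I : left_ideal S I -> ~ I e ->
  exists2 M, maximal_left_ideal S M & I `<=` M.
Proof.
move=> idI nIe.
pose P X := left_ideal S (I `|` X) /\ ~ (I `|` X) e.
have [F FP totF|N [[idN nNe] maxN]] := @Zorn_bigcup T P.
  split; last by case=> // -[X /FP[_ nX] Xe]; apply: nX; right.
  have sub X x y : F X -> (I `|` X) x -> (I `|` X) y ->
      (I `|` \bigcup_(Z in F) Z) (x - y).
    move=> FX Xx Xy; have [[_ _ XB _] _] := FP X FX.
    by have [|Z] := XB x y Xx Xy; [left|right; exists X].
  case: (idI) => IS I0 IB IM; split.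
  - by move=> x [/IS //|[X FX Xx]]; have [[XS _ _ _] _] := FP X FX; apply: XS; right.
  - by left.
  - move=> x y [Ix|[X FX Xx]] [Iy|[Y FY Yy]].
    + by left; apply: IB.
    + by apply: (sub Y) => //; [left|right].
    + by apply: (sub X) => //; [right|left].
    + by case: (totF X Y FX FY) => XY;
        [apply: (sub Y) | apply: (sub X)] => //; right => //; apply: XY.
  - move=> a x Sa [Ix|[X FX Xx]]; first by left; apply: IM.
    have [[_ _ _ XM] _] := FP X FX.
    by have [|Z] := XM a x Sa (or_intror Xx); [left|right; exists X].
exists (I `|` N); last by left.
split=> // [eqS|L idL INL]; first by apply: nNe; rewrite eqS.
have [Le|nLe] := pselect (L e); first by right; apply: left_ideal_full.
left; apply: contrapT => neq; apply: (maxN L).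
  split; first by move=> x Nx; apply: INL; right.
  by move=> LN; apply: neq; apply/seteqP; split=> // x /LN; right.
have -> : P L = (left_ideal S L /\ ~ L e) by rewrite /P setUidr // => x Ix; apply: INL; left.
by [].
Qed.

(** If z = e - a x has no left inverse, a maximal left ideal over S z contains x, hence e.
    Conversely, if a maximal M misses x, then M + S x = S writes e as m + a x, and the left inverse
    of e - a x = m puts e into M. *)
Lemma jacobsonP x : jacobson S x <->
  S x /\ forall a, S a -> exists2 y, S y & y * (e - a * x) = e.
Proof.
split=> [[Sx Jx]|[Sx invx]]; split=> //; [move=> a Sa|move=> M [idM neqM maxM]].
  apply: contrapT => nex.
  pose z := e - a * x; have Sz : S z by apply: (SB) => //; apply: (SM).
  have idI : left_ideal S [set b * z | b in S].
    split=> [_ [b Sb <-]||_ _ [b Sb <-] [c Sc <-]|b _ Sb [c Sc <-]].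
    - exact: SM.
    - by exists 0; [apply: subring_with0 | rewrite mul0r].
    - by exists (b - c); [apply: (SB) | rewrite mulrBl].
    - by exists (b * c); [apply: (SM) | rewrite mulrA].
  have [|M maxM IM] := sub_maximal_left_ideal idI.
    by case=> y Sy yz; apply: nex; exists y.
  have [idM neqM _] := maxM; have [MS M0 MB MM] := idM.
  apply: neqM; apply: left_ideal_full => //.
  have -> : e = z - (0 - a * x) by rewrite sub0r opprK subrK.
  apply: (MB); first by apply: IM; exists e => //; apply: Sel.
  by apply: (MB) => //; apply: (MM) => //; apply: (Jx).
apply: contrapT => nMx; have [MS M0 MB MM] := idM.
have MD u v : M u -> M v -> M (u + v).
  by move=> Mu Mv; rewrite -[v]opprK -[- v]sub0r; apply: (MB) => //; apply: (MB).
pose L := [set m + a * x | m in M & a in S].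
have idL : left_ideal S L.
  split=> [_ [m Mm] [a Sa <-]||_ _ [m Mm] [a Sa <-] [m' Mm'] [a' Sa' <-]
           |b _ Sb [m Mm] [a Sa <-]].
  - by apply: subring_withD; [apply: MS | apply: SM].
  - by exists 0 => //; exists 0; [apply: subring_with0 | rewrite mul0r addr0].
  - exists (m - m'); first exact: MB.
    by exists (a - a'); [apply: (SB) | rewrite mulrBl opprD addrACA].
  - exists (b * m); first exact: MM.
    by exists (b * a); [apply: (SM) | rewrite mulrDr mulrA].
have Lx : L x by exists 0 => //; exists e => //; rewrite add0r Sel.
have [m Mm|LM|LS] := maxM L idL.
- by exists m => //; exists 0; [apply: subring_with0 | rewrite mul0r addr0].
- by apply: nMx; rewrite -LM.
have [m Mm [a Sa max]] : L e by rewrite LS.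
have [y Sy yM] := invx a Sa.
apply: neqM; apply: left_ideal_full => //.
by rewrite -yM -max addrK; apply: (MM).
Qed.

Lemma jacobson_two_sided : two_sided_ideal S (jacobson S).
Proof.
have ideal : left_ideal S (jacobson S).
  split=> [x []//||x y [Sx Jx] [Sy Jy]|a x Sa [Sx Jx]].
  - by split; [apply: subring_with0 | move=> M [[]]].
  - split; first exact: SB.
    by move=> M maxM; have [[_ _ MB _] _ _] := maxM; apply: (MB); [apply: Jx|apply: Jy].
  - split; first exact: SM.
    by move=> M maxM; have [[_ _ _ MM] _ _] := maxM; apply: (MM) => //; apply: (Jx).
split=> // x b Jx Sb; have [Sx invx] := (jacobsonP x).1 Jx.
apply/jacobsonP; split=> [|a Sa]; first exact: SM.
have [y Sy yinv] := invx _ (SM Sb Sa).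
(* (1 - uv)^{-1} = 1 + u (1 - vu)^{-1} v with u = a x, v = b *)
exists (e + a * x * y * b).
  by apply: subring_withD => //; do ?apply: (SM).
rewrite mulrDl mulrBr !Sel //; last by do ?apply: (SM).
have -> : a * x * y * b * (e - a * (x * b)) = a * x * (y * (e - b * a * x)) * b.
  by rewrite !mulrBr !mulrBl !mulrA -!(mulrA _ _ e) Ser ?Ser ?Sel //; do ?apply: (SM).
by rewrite yinv -!mulrA Sel // !mulrA subrK.
Qed.

(** If y (e - c) = e, then c = y (e - c) c = 0. *)
Lemma idempotent_jacobson c : jacobson S c -> c * c = c -> c = 0.
Proof.
move=> /jacobsonP[Sc invc] cc; have [y Sy yinv] := invc e Se.
by rewrite -(Sel Sc) -yinv -mulrA mulrBl !Sel // cc subrr mulr0.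
Qed.

Lemma peirce_subring c : S c -> c * c = c -> subring_with (peirce c S c) c.
Proof.
move=> Sc cc; split.
- by exists c; rewrite ?cc.
- by move=> _ _ [a Sa <-] [b Sb <-]; exists (a - b); [apply: (SB) | rewrite mulrBr mulrBl].
- move=> _ _ [a Sa <-] [b Sb <-]; exists (a * c * b); first by do ?apply: (SM).
  by rewrite !mulrA -(mulrA (c * a) c c) cc.
- by move=> _ [a Sa <-]; rewrite !mulrA cc -!mulrA cc.
Qed.

End Jacobson.

Lemma peirceP S c x : c * c = c -> peirce c S c x -> c * x = x /\ x * c = x.
Proof. by move=> cc [a _ <-]; rewrite !mulrA cc -!mulrA cc. Qed.

(** If y is a left inverse of c - x (c a c) in the corner, then 1 + a y x is a left inverse of 1 - a
    x. Such a y exists because the radical of the corner is also closed under right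
    multiplication. *)
Lemma jacobson_peirce S c : subring_with S 1 -> S c -> c * c = c ->
  jacobson (peirce c S c) `<=` jacobson S.
Proof.
move=> ringS Sc cc x Jx; have [S1 SB SM _] := ringS.
have ringP := peirce_subring ringS Sc cc.
have [[PS P0 PB PM] PMr] := jacobson_two_sided ringP.
have Px := PS _ Jx; have [cx xc] := peirceP cc Px.
have sPS : peirce c S c `<=` S by move=> _ [a Sa <-]; do ?apply: (SM).
apply/(jacobsonP ringS); split=> [|a Sa]; first exact: sPS.
have Pa : peirce c S c (c * a * c) by exists a.
have [Pc _ _ _] := ringP.
have [y Py yinv] := ((jacobsonP ringP _).1 (PMr _ _ Jx Pa)).2 c Pc.
exists (1 + a * y * x).
  by apply: (subring_withD ringS) => //; do ?apply: (SM) => //; apply: (sPS).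
have yx : y * (x - x * a * x) = x.
  have -> : x - x * a * x = (c - c * (x * (c * a * c))) * x.
    by rewrite mulrBl !mulrA cx xc -!mulrA cx.
  by rewrite mulrA yinv.
have -> : (1 + a * y * x) * (1 - a * x) = 1 - a * x + a * (y * (x - x * a * x)).
  by rewrite mulrDl mul1r !mulrBr mulr1 !mulrA.
by rewrite yx subrK.
Qed.

(** For a and x in the corner, c commutes with 1 - a x, so a left inverse y of 1 - a x gives the
    left inverse c y c of c - a x. *)
Lemma jacobson_sub_peirce S c : subring_with S 1 -> S c -> c * c = c ->
  peirce c S c `&` jacobson S `<=` jacobson (peirce c S c).
Proof.
move=> ringS Sc cc x [Px Jx]; have [_ _ SM _] := ringS.
have ringP := peirce_subring ringS Sc cc.
apply/(jacobsonP ringP); split=> // a Pa.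
have [ca ac] := peirceP cc Pa; have [cx xc] := peirceP cc Px.
have Sa : S a by case: Pa => b Sb <-; do ?apply: (SM).
have [_ /(_ a Sa)[y Sy yinv]] := (jacobsonP ringS x).1 Jx.
exists (c * y * c); first by exists y.
have comm : c * (1 - a * x) = (1 - a * x) * c.
  by rewrite mulrBr mulrBl mulr1 mul1r mulrA ca -mulrA xc.
have -> : c - a * x = (1 - a * x) * c by rewrite mulrBl mul1r -mulrA xc.
rewrite -comm !mulrA -(mulrA (c * y) c c) cc -(mulrA (c * y)) comm.
by rewrite mulrA -(mulrA c y) yinv mulr1 cc.
Qed.

End Subrings.

(** * Congruences and simple quotients *)

Section Congruences.
Context {T : pzRingType}.
Variables (S I : set T).
Hypothesis idI : two_sided_ideal S I.
Implicit Types (a b c d x y : T).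

Definition eqmod x y := I (x - y).

Let IS x : I x -> S x. Proof. by case: idI => -[/(_ x)]. Qed.
Let IB x y : I x -> I y -> I (x - y). Proof. by case: idI => -[_ _ /(_ x y)]. Qed.

Lemma two_sided_ideal0 : I 0. Proof. by case: idI => -[]. Qed.

Lemma two_sided_idealN x : I x -> I (- x).
Proof. by rewrite -sub0r; apply: IB; apply: two_sided_ideal0. Qed.

Lemma two_sided_idealD x y : I x -> I y -> I (x + y).
Proof. by move=> Ix /two_sided_idealN Iy; rewrite -[y]opprK; apply: IB. Qed.

Lemma two_sided_idealMl a x : S a -> I x -> I (a * x).
Proof. by case: idI => -[_ _ _ /(_ a x)]. Qed.

Lemma two_sided_idealMr x a : I x -> S a -> I (x * a).
Proof. by case: idI => _ /(_ x a). Qed.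

Lemma eqmodxx x : eqmod x x.
Proof. by rewrite /eqmod subrr; apply: two_sided_ideal0. Qed.

Lemma eqmod_sym x y : eqmod x y -> eqmod y x.
Proof. by rewrite /eqmod -[y - x]opprB => /two_sided_idealN. Qed.

Lemma eqmod_trans y x z : eqmod x y -> eqmod y z -> eqmod x z.
Proof. by rewrite /eqmod => /two_sided_idealD h /h; rewrite addrA subrK. Qed.

Lemma eqmodMl a x y : S a -> eqmod x y -> eqmod (a * x) (a * y).
Proof. by rewrite /eqmod -mulrBr; apply: two_sided_idealMl. Qed.

Lemma eqmodMr a x y : S a -> eqmod x y -> eqmod (x * a) (y * a).
Proof. by rewrite /eqmod -mulrBl => Sa /two_sided_idealMr; apply. Qed.

Lemma eqmodB x y z t : eqmod x y -> eqmod z t -> eqmod (x - z) (y - t).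
Proof. by rewrite /eqmod opprD addrACA -opprD; apply: IB. Qed.

Lemma eqmodD x y z t : eqmod x y -> eqmod z t -> eqmod (x + z) (y + t).
Proof. by rewrite /eqmod opprD addrACA; apply: two_sided_idealD. Qed.

Lemma eqmod0 x : eqmod x 0 <-> I x.
Proof. by rewrite /eqmod subr0. Qed.

Lemma eqmod_ideal x y : eqmod x y -> I y -> I x.
Proof. by rewrite -!eqmod0; apply: eqmod_trans. Qed.

End Congruences.

Section SimpleQuotient.
Context {T : pzRingType}.
Variables (S G : set T) (e : T).
Hypotheses (ringS : subring_with S e) (ringG : subring_with G e).
Hypothesis sSG : S `<=` G.
Hypothesis iso : quotient_bimodule_iso S S (jacobson S) G (jacobson G).
Hypothesis primS : forall x, central_idempotent_mod S (jacobson S) x ->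
  jacobson S x \/ jacobson S (e - x).

(* The isomorphism is b |-> b u with u the image of e. If c = b u and
   u u = w u modulo the radicals, then b and w are central in S / J(S) and
   b w is idempotent there: b w = 0 gives c = 0 and b w = e gives c = e. *)
Lemma central_idempotent_trivial c : G c -> c * c = c ->
  (forall g, G g -> c * g = g * c) ->
  c = 0 \/ c = e.
Proof.
move=> Gc cc cG.
have JS := jacobson_two_sided ringS; have JG := jacobson_two_sided ringG.
have [Se SB SM Sid] := ringS; have [Ge GB GM Gid] := ringG.
have [phi [phiG phiD phiM phi0 phi_surj]] := iso.
pose u := phi e; have Gu : G u by apply: phiG.
have phil a : S a -> eqmod (jacobson G) (phi a) (a * u).
  by move=> Sa; have := (phiM a e Sa Se).1; rewrite (Sid a Sa).2.
have phir a : S a -> eqmod (jacobson G) (phi a) (u * a).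
  by move=> Sa; have := (phiM a e Sa Se).2; rewrite (Sid a Sa).1.
have uC a : S a -> eqmod (jacobson G) (a * u) (u * a).
  by move=> Sa; apply: (eqmod_trans JG (eqmod_sym JG (phil a Sa))); apply: phir.
(* Multiplication by [u] is injective from S / J(S) to G / J(G). The congruences in [S] for [bC],
   [wC] and [bbw] are proved by multiplying by [u] and computing in [G]. *)
have ker a : S a -> jacobson G (a * u) <-> jacobson S a.
  move=> Sa; rewrite -(phi0 a Sa).
  by split; apply: (eqmod_ideal JG); [|apply: (eqmod_sym JG)]; apply: phil.
have surj y : G y -> exists2 a, S a & eqmod (jacobson G) y (a * u).
  move=> /phi_surj[a Sa ya]; exists a => //.
  exact: (eqmod_trans JG ya (phil a Sa)).
have [b Sb cb] := surj c Gc.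
have [w Sw uw] := surj _ (GM _ _ Gu Gu).
have [v Sv ev] := surj e Ge.
have Gb := sSG Sb; have Gw := sSG Sw; have Gv := sSG Sv.
have bC a : S a -> eqmod (jacobson S) (a * b) (b * a).
  move=> Sa; have Ga := sSG Sa.
  apply/ker; first by apply: (SB); apply: (SM).
  rewrite mulrBl -!mulrA; apply: (eqmod_trans JG (y := a * c)).
    by apply: (eqmodMl JG) => //; apply: (eqmod_sym JG).
  rewrite -cG //; apply: (eqmod_trans JG (y := b * u * a)).
    exact: (eqmodMr JG).
  by rewrite -mulrA; apply: (eqmodMl JG) => //; apply: (eqmod_sym JG); apply: uC.
have wC a : S a -> eqmod (jacobson S) (a * w) (w * a).
  move=> Sa; have Ga := sSG Sa.
  apply/ker; first by apply: (SB); apply: (SM).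
  rewrite mulrBl -!mulrA; apply: (eqmod_trans JG (y := a * (u * u))).
    by apply: (eqmodMl JG) => //; apply: (eqmod_sym JG).
  apply: (eqmod_trans JG (y := u * u * a)).
    rewrite mulrA; apply: (eqmod_trans JG (y := u * a * u)).
      by apply: (eqmodMr JG) => //; apply: uC.
    by rewrite -!mulrA; apply: (eqmodMl JG) => //; apply: uC.
  apply: (eqmod_trans JG (y := w * u * a)); first exact: (eqmodMr JG).
  by rewrite -mulrA; apply: (eqmodMl JG) => //; apply: (eqmod_sym JG); apply: uC.
(* Modulo J(G), b b w u = b b u u = (b u)(b u) = c c = c = b u. *)
have bbw : eqmod (jacobson S) (b * b * w) b.
  apply/ker; first by apply: (SB) => //; do ?apply: (SM).
  rewrite mulrBl -(mulrA _ w); apply: (eqmod_trans JG (y := b * b * (u * u))).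
    by apply: (eqmodMl JG); [apply: GM|apply: (eqmod_sym JG)].
  have -> : b * b * (u * u) = b * (b * u) * u by rewrite !mulrA.
  apply: (eqmod_trans JG (y := b * (u * b) * u)).
    by apply: (eqmodMr JG) => //; apply: (eqmodMl JG) => //; apply: uC.
  have -> : b * (u * b) * u = (b * u) * (b * u) by rewrite !mulrA.
  apply: (eqmod_trans JG (y := c * (b * u))).
    by apply: (eqmodMr JG); [apply: GM|apply: (eqmod_sym JG)].
  apply: (eqmod_trans JG (y := c * c)).
    by apply: (eqmodMl JG) => //; apply: (eqmod_sym JG).
  by rewrite cc.
have Sbw : S (b * w) by apply: SM.
case: (@primS (b * w)) => [|Jbw|Jbw].
- split=> // [|a Sa].
    apply: (eqmod_trans JS (y := b * b * w * w)).
      rewrite -!mulrA; apply: (eqmodMl JS) => //; rewrite !mulrA.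
      by apply: (eqmodMr JS) => //; apply: (eqmod_sym JS); apply: wC.
    exact: (eqmodMr JS).
  apply: (eqmod_trans JS (y := b * (a * w))).
    rewrite -mulrA; apply: (eqmodMl JS) => //.
    by apply: (eqmod_sym JS); apply: wC.
  rewrite !mulrA; apply: (eqmodMr JS) => //.
  by apply: (eqmod_sym JS); apply: bC.
- left; apply: (idempotent_jacobson ringG) => //.
  apply: (eqmod_ideal JG cb); apply/ker => //.
  apply: (eqmod_ideal JS (eqmod_sym JS bbw)).
  by rewrite -mulrA; apply: (two_sided_idealMl JS).
- right; apply/eqP; rewrite -subr_eq0 -oppr_eq0 opprB; apply/eqP.
  apply: (idempotent_jacobson ringG); last first.
    by rewrite mulrBr !mulrBl cc (Gid e Ge).1 (Gid c Gc).1 (Gid c Gc).2 subrr subr0.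
  have Gec : G (e - c) by apply: GB.
  (* As b w = e modulo J(S), one has u = b w u = w b u = w c modulo J(G). With e = v u this gives e
     - c = v w c (e - c) = 0 modulo J(G), and an idempotent in the radical vanishes. *)
  have uwc : eqmod (jacobson G) u (w * c).
    have /ker Jbwu : jacobson S (e - b * w) by [].
    apply: (eqmod_trans JG (y := b * w * u)).
      rewrite -{1}(Gid u Gu).1 /eqmod -mulrBl; apply: Jbwu.
      exact: SB.
    apply: (eqmod_trans JG (y := w * b * u)).
      rewrite /eqmod -mulrBl; apply/ker; first by apply: SB => //; apply: SM.
      exact: wC.
    by rewrite -mulrA; apply: (eqmodMl JG) => //; apply: (eqmod_sym JG).
  rewrite -(Gid _ Gec).1; apply/eqmod0.
  apply: (eqmod_trans JG (y := v * u * (e - c))); first exact: (eqmodMr JG).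
  apply: (eqmod_trans JG (y := v * (w * c) * (e - c))).
    by apply: (eqmodMr JG) => //; apply: (eqmodMl JG).
  by rewrite -!mulrA mulrBr (Gid c Gc).2 cc subrr !mulr0; apply: (eqmodxx JG).
Qed.

End SimpleQuotient.

(** Modulo J(S), [e] is central, so x a = x (e a e) = (e a e) x = a x and [x] is central in all of
    [S]. Primitivity then applies to e = x + (e - x), and the radical of the corner is its
    intersection with J(S). *)
Lemma corner_primitive (T : pzRingType) (S : set T) (e x : T) :
  subring_with S 1 -> central_primitive_mod S (jacobson S) e -> e * e = e ->
  central_idempotent_mod (peirce e S e) (jacobson (peirce e S e)) x ->
  jacobson (peirce e S e) x \/ jacobson (peirce e S e) (e - x).
Proof.
move=> ringS [[Se _ eC] nJe prime] ee [Px xx xC].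
have JS := jacobson_two_sided ringS; have [S1 SB SM Sid] := ringS.
have JP := jacobson_peirce ringS Se ee; have [ex xe] := peirceP ee Px.
have Sx : S x by case: Px => a Sa <-; do ?apply: (SM).
have [JSx JSe] : central_idempotent_mod S (jacobson S) x
              /\ central_idempotent_mod S (jacobson S) (e - x).
  have xC' a : S a -> eqmod (jacobson S) (x * a) (a * x).
    move=> Sa; apply: (eqmod_trans JS (y := x * (e * a * e))).
      rewrite -{1}xe -mulrA -{1}ee -!mulrA; apply: (eqmodMl JS) => //.
      by apply: (eqmodMl JS) => //; apply: eC.
    apply: (eqmod_trans JS (y := (e * a * e) * x)).
      by apply: JP; apply: xC; exists a.
    rewrite -mulrA ex -[in a * x]ex mulrA; apply: (eqmodMr JS) => //.
    exact: eC.
  split; split=> //.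
  - by apply: JP.
  - exact: SB.
  - have -> : (e - x) * (e - x) - (e - x) = x * x - x.
      by rewrite mulrBr !mulrBl ee ex xe addrAC subrr sub0r opprB.
    exact: JP.
  - by move=> a Sa; rewrite mulrBl mulrBr; apply: (eqmodB JS); [apply: eC|apply: xC'].
case: (prime x (e - x) JSx JSe) => [||Jx|Jx].
- by rewrite mulrBr xe -opprB; apply: (two_sided_idealN JS); apply: JP.
- by rewrite [x + _]addrC subrK subrr; apply: (two_sided_ideal0 JS).
- by left; apply: jacobson_sub_peirce.
- right; apply: jacobson_sub_peirce => //; split=> //.
  have [Pe PB _ _] := peirce_subring ringS Se ee; exact: PB.
Qed.

(** * Hereditary rings *)

Section AdditiveSubgroups.
Context {V : zmodType}.

(** Projectivity quantifies over modules carried by a [zmodType]; this record and its subtype turn a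
    left ideal, given as a set, into such a type. *)
Record additive_subgroup := AdditiveSubgroup {
  subgroup_set : set V;
  subgroup_set0 : subgroup_set 0;
  subgroup_setB x y : subgroup_set x -> subgroup_set y -> subgroup_set (x - y) }.

Variable D : additive_subgroup.

Definition subgroup_pred : pred V := fun x => `[< subgroup_set D x >].

Fact subgroup_pred_closed : zmod_closed subgroup_pred.
Proof.
split=> [|x y /asboolP Dx /asboolP Dy]; apply/asboolP; first exact: subgroup_set0.
exact: subgroup_setB.
Qed.
HB.instance Definition _ :=
  GRing.isZmodClosed.Build V subgroup_pred subgroup_pred_closed.

Definition subgroup_type := {x : V | subgroup_pred x}.
HB.instance Definition _ := SubChoice.on subgroup_type.
HB.instance Definition _ := [SubChoice_isSubZmodule of subgroup_type by <:].

Lemma subgroup_typeP (m : subgroup_type) : subgroup_set D (val m).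
Proof. exact/asboolP/(valP m). Qed.

Lemma subgroup_valD (m n : subgroup_type) : val (m + n) = val m + val n.
Proof. exact: (raddfD (val : subgroup_type -> V)). Qed.

Lemma subgroup_val_inj (m n : subgroup_type) : val m = val n -> m = n.
Proof. exact: val_inj. Qed.

End AdditiveSubgroups.

Section SubgroupModule.
Context {T : pzRingType}.
Variables (S : set T) (D : @additive_subgroup T).
Hypothesis SD : forall a x, S a -> subgroup_set D x -> subgroup_set D (a * x).

(** The action must be total on [T]; for [a] in [S] the product stays in [D], so the default 0 does
    not interfere. *)
Definition subgroup_act (a : T) (m : subgroup_type D) : subgroup_type D :=
  insubd 0 (a * val m).

Lemma val_subgroup_act a m : S a -> val (subgroup_act a m) = a * val m.
Proof. by move=> Sa; apply: insubdK; apply/asboolP/SD/subgroup_typeP. Qed.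

Lemma subgroup_is_left_module : S 1 -> (forall a b, S a -> S b -> S (a + b)) ->
  (forall a b, S a -> S b -> S (a * b)) -> is_left_module S subgroup_act.
Proof.
move=> S1 SA SM; split=> [m|a m n Sa|a b m Sa Sb|a b m Sa Sb]; apply: subgroup_val_inj.
- by rewrite val_subgroup_act // mul1r.
- by rewrite subgroup_valD !val_subgroup_act // subgroup_valD mulrDr.
- by rewrite subgroup_valD !val_subgroup_act // ?mulrDl //; apply: SA.
- by rewrite !val_subgroup_act // ?mulrA //; apply: SM.
Qed.

End SubgroupModule.

(* Right multiplication by c eps maps S onto the left ideal S c eps; a
   splitting sends c eps to an element y with y eps = eps and eps y = y. *)
Lemma hereditary_central_idempotent (T : pzRingType) (S : set T) (c eps : T) :
  subring_with S 1 -> hereditary S -> S c -> S (c * eps) ->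
  (forall x, c * x = x * c) -> (forall x y, c * x = c * y -> x = y) ->
  eps * eps = eps -> (forall x, eps * x = x * eps) -> S eps.
Proof.
move=> ringS hered Sc Sceps cC c_inj epseps epsC; have [S1 SB SM _] := ringS.
have S0 := subring_with0 ringS; have SA := subring_withD ringS.
pose I := [set a * (c * eps) | a in S].
have I0 : I 0 by exists 0; rewrite ?mul0r.
have IB x y : I x -> I y -> I (x - y).
  by move=> [a Sa <-] [b Sb <-]; exists (a - b); [apply: SB|rewrite mulrBl].
have IM a x : S a -> I x -> I (a * x).
  by move=> Sa [b Sb <-]; exists (a * b); [apply: SM|rewrite -mulrA].
have IS : I `<=` S by move=> _ [a Sa <-]; apply: SM.
pose DS := AdditiveSubgroup S0 SB; pose DI := AdditiveSubgroup I0 IB.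
have modS := @subgroup_is_left_module _ S DS SM S1 SA SM.
have modI := @subgroup_is_left_module _ S DI IM S1 SA SM.
(* [g] is the surjection of [S] onto [I], and [f] below is the identity of [I]; lifting [f] through
   [g] splits [g]. *)
pose g (m : subgroup_type DS) : subgroup_type DI := insubd 0 (val m * (c * eps)).
have valg m : val (g m) = val m * (c * eps).
  by apply: insubdK; apply/asboolP; exists (val m) => //; apply: (subgroup_typeP m).
have homg : module_hom S (@subgroup_act _ DS) (@subgroup_act _ DI) setT g.
  split=> [x y _ _|a x Sa _]; apply: subgroup_val_inj.
    by rewrite subgroup_valD !valg subgroup_valD mulrDl.
  by rewrite (@val_subgroup_act _ S DI IM) // !valg (@val_subgroup_act _ S DS SM) // -mulrA.
have surjg n : exists m, g m = n.
  have [a Sa an] := subgroup_typeP n.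
  have Pa : subgroup_pred DS a by apply/asboolP.
  by exists (Sub a Pa); apply: subgroup_val_inj; rewrite valg SubK.
pose f (x : T) : subgroup_type DI := insubd 0 x.
have valf x : I x -> val (f x) = x by move=> Ix; apply: insubdK; apply/asboolP.
have homf : module_hom S *%R (@subgroup_act _ DI) I f.
  split=> [x y Ix Iy|a x Sa Ix]; apply: subgroup_val_inj.
    rewrite subgroup_valD !valf // -[y]opprK; apply: (IB) => //.
    by rewrite -sub0r; apply: (IB).
  by rewrite (@val_subgroup_act _ S DI IM) // !valf //; apply: (IM).
have [f' [f'D f'M] f'g] := hered I (And4 IS I0 IB IM) _ _ _ _ modS modI g homg surjg f homf.
have Iceps : I (c * eps) by exists 1; rewrite ?mul1r.
set y := val (f' (c * eps)).
have yeps : y * eps = eps.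
  have := congr1 val (f'g _ Iceps); rewrite valg valf // => yceps.
  by apply: (c_inj); rewrite mulrA cC -mulrA.
have epsy : eps * y = y.
  (* By linearity of [f'], both c eps y and c y are the value of [f'] at c c eps. The factor [c] is
     needed because [eps] is not yet known to lie in [S]. *)
  apply: (c_inj); rewrite mulrA.
  rewrite -(@val_subgroup_act _ S DS SM) // -f'M // -(@val_subgroup_act _ S DS SM) // -f'M //.
  by rewrite -!mulrA (mulrA eps) epsC -!mulrA epseps.
by rewrite -yeps -epsC epsy; apply: (subgroup_typeP (f' (c * eps))).
Qed.

(** * Central idempotents modulo an ideal *)

(** The parts of a nontrivial decomposition x = c + d lie below x, since c x = c (c + d) = c modulo
    I, and likewise for d. *)
Lemma split_central_idempotent (T : pzRingType) (S I : set T) (x : T) :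
  subring_with S 1 -> two_sided_ideal S I ->
  central_idempotent_mod S I x -> ~ I x -> ~ central_primitive_mod S I x ->
  exists c d, [/\ central_idempotent_mod S I c /\ ~ I c,
    central_idempotent_mod S I d /\ ~ I d, I (c * d),
    I (c - c * x) & I (d - d * x)].
Proof.
move=> ringS idI idx nIx nprim; have [S1 SB SM Sid] := ringS.
have [c [d [[idc nIc] [idd nId] Icd Ixcd]]] : exists c d,
    [/\ central_idempotent_mod S I c /\ ~ I c, central_idempotent_mod S I d /\ ~ I d,
        I (c * d) & I (x - (c + d))].
  apply: contrapT => nex; apply: nprim; split=> // c d idc idd Icd Ixcd.
  have [Ic|nIc] := pselect (I c); first by left.
  have [Id|nId] := pselect (I d); first by right.
  by case: nex; exists c, d.
have [Sc cc cC] := idc; have [Sd dd dC] := idd.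
exists c, d; split=> //.
  apply: (eqmod_sym idI); apply: (eqmod_trans idI (y := c * (c + d))).
    exact: (eqmodMl idI).
  rewrite mulrDr -[X in eqmod I _ X]addr0; apply: (eqmodD idI) => //.
  by apply/eqmod0.
apply: (eqmod_sym idI); apply: (eqmod_trans idI (y := d * (c + d))).
  exact: (eqmodMl idI).
rewrite mulrDr -[X in eqmod I _ X]add0r; apply: (eqmodD idI) => //.
by apply: (eqmod_trans idI (y := c * d)); [apply: dC|apply/eqmod0].
Qed.

(** If nothing primitive lay below [d], repeated splitting would produce N + 1 orthogonal central
    idempotents, all nonzero modulo [I], against the bound. *)
Lemma central_primitive_below (T : pzRingType) (S I : set T) (d : T) (N : nat) :
  subring_with S 1 -> two_sided_ideal S I ->
  (forall x : nat -> T,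
     (forall k, (k <= N)%N -> central_idempotent_mod S I (x k)) ->
     (forall i j, (i <= N)%N -> (j <= N)%N -> i != j -> I (x i * x j)) ->
     exists2 k, (k <= N)%N & I (x k)) ->
  central_idempotent_mod S I d -> ~ I d ->
  exists2 c, central_primitive_mod S I c & I (c - c * d).
Proof.
move=> ringS idI bound idd nId; have [S1 SB SM Sid] := ringS.
apply: contrapT => nex.
have [x xid xorth] : exists2 x : nat -> T,
    forall k, (k <= N)%N -> [/\ central_idempotent_mod S I (x k), ~ I (x k)
                               & I (x k - x k * d)]
    & forall i j, (i <= N)%N -> (j <= N)%N -> i != j -> I (x i * x j); last first.
  have [k lekN Ixk] := bound x (fun k le => let: And3 h _ _ := xid k le in h) xorth.
  by have [_ + _] := xid k lekN.
(* The family starts with [d] alone. At each stage its last member is split in two, and the parts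
   take the positions m and m + 1. *)
elim: {bound} N => [|m [x xid xorth]].
  exists (fun=> d) => [k _|[|i] [|j]] //; split=> //.
  by apply: (eqmod_sym idI); case: idd.
have [idm nIm md] := xid m (leqnn m).
have nprim : ~ central_primitive_mod S I (x m) by move=> prim; apply: nex; exists (x m).
have [c [c' [[idc nIc] [idc' nIc'] Icc' Icx Icx']]] :=
  split_central_idempotent ringS idI idm nIm nprim.
have Sx k : (k <= m)%N -> S (x k) by move=> /xid[[]].
have Sd : S d by case: idd.
have below y : central_idempotent_mod S I y -> I (y - y * x m) ->
    I (y - y * d) /\ forall k, (k < m)%N -> I (y * x k) /\ I (x k * y).
  move=> [Sy _ yC] yx; split.
    apply: (eqmod_trans idI (y := y * x m * d)); last first.
      by apply: (eqmodMr idI) => //; apply: (eqmod_sym idI).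
    apply: (eqmod_trans idI yx); rewrite -mulrA; exact: (eqmodMl idI).
  move=> k ltkm; have Iyx : I (y * x k).
    apply: (eqmod_ideal idI (y := y * x m * x k)).
      by apply: (eqmodMr idI) => //; apply: Sx; apply: ltnW.
    rewrite -mulrA; apply: (two_sided_idealMl idI) => //.
    by apply: xorth => //; [apply: ltnW|rewrite gtn_eqF].
  split=> //; apply: (eqmod_ideal idI (y := y * x k)) => //.
  by apply: (eqmod_sym idI); apply: yC; apply: Sx; apply: ltnW.
have [cd cx] := below c idc Icx; have [c'd c'x] := below c' idc' Icx'.
have Ic'c : I (c' * c).
  by apply: (eqmod_ideal idI (y := c * c')) => //; case: idc' => _ _; apply; case: idc.
exists (fun k => if (k < m)%N then x k else if k == m then c else c').
  move=> k _; case: ltnP => [ltkm|_]; first by apply: xid; apply: ltnW.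
  by case: eqP.
have last k : (k <= m.+1)%N -> (m <= k)%N -> k != m -> k = m.+1.
  by move=> lekm lemk nkm; apply/eqP; rewrite eqn_leq lekm ltn_neqAle eq_sym nkm.
move=> i j leim lejm neqij.
case: (ltnP i m) => [ltim|leim'].
  case: (ltnP j m) => [ltjm|lejm']; first by apply: xorth => //; apply: ltnW.
  by case: eqP => _; [apply: (cx i ltim).2|apply: (c'x i ltim).2].
case: (ltnP j m) => [ltjm|lejm'].
  by case: eqP => _; [apply: (cx j ltjm).1|apply: (c'x j ltjm).1].
have [eim|nim] := eqVneq i m; have [ejm|njm] := eqVneq j m => //.
  by rewrite eim ejm eqxx in neqij.
by rewrite (last i) // (last j) // eqxx in neqij.
Qed.

(** * Orders over a discrete valuation ring *)

(** A nonunit generates a proper ideal, which lies in the only maximal ideal, that of the multiples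
    of [pi]. *)
Lemma dvr_unit (R : idomainType) (pi r : R) :
  dvr pi -> ~ (exists s, r = s * pi) -> r \is a GRing.unit.
Proof.
move=> [_ maxpi _] npi.
have ringR : subring_with [set: R] 1 by split=> // x; rewrite mul1r mulr1.
have [|nunit] := pselect ((range (fun s : R => s * r)) 1).
  by case=> s _ sr; apply/unitrP; exists s; rewrite sr mulrC.
have idI : left_ideal setT (range (fun s : R => s * r)).
  split=> // [|_ _ [s _ <-] [s' _ <-]|a _ _ [s _ <-]].
  - by exists 0; rewrite ?mul0r.
  - by exists (s - s'); rewrite ?mulrBl.
  - by exists (a * s); rewrite ?mulrA.
have [M /maxpi -> sub] := sub_maximal_left_ideal ringR idI nunit.
by case: npi; have [|s _ <-] := sub r; [exists 1; rewrite ?mul1r|exists s].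
Qed.

Lemma dvr_nonunit (R : idomainType) (pi s : R) : dvr pi -> s * pi != 1.
Proof.
move=> [_ maxpi _]; have [_ neq _] := (maxpi _).2 erefl.
apply/eqP => spi; apply: neq; apply/seteqP; split=> // x _.
by exists (x * s) => //; rewrite -mulrA spi mulr1.
Qed.

(** The polynomial det(1 - X C) takes the value 1 at 0, so its value at [pi] is 1 plus a multiple of
    [pi], hence a unit. *)
Lemma det_one_sub_scale_unit (R : idomainType) (pi : R) n (C : 'M[R]_n) :
  dvr pi -> 1%:M - pi *: C \in unitmx.
Proof.
move=> dvrR; rewrite unitmxE.
pose P : 'M[{poly R}]_n := 1%:M - 'X *: map_mx polyC C.
have detP x : (\det P).[x] = \det (1%:M - x *: C).
  have -> : 1%:M - x *: C = map_mx (horner_eval x) P.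
    apply/matrixP => i j; rewrite !mxE /horner_eval.
    by rewrite !hornerE hornerMn hornerE.
  by rewrite det_map_mx.
have /factor_theorem[q qE] : root (\det P - 1%:P) 0.
  by rewrite /root hornerD hornerN hornerC detP scale0r subr0 det1 subrr.
have detpi : \det (1%:M - pi *: C) = q.[pi] * pi + 1.
  by rewrite -detP -[\det P](subrK 1%:P) qE hornerD hornerM hornerXsubC subr0 hornerC.
apply: (dvr_unit dvrR) => -[s detE].
have := dvr_nonunit (s - q.[pi]) dvrR; rewrite mulrBl -detE detpi.
by rewrite addrC addKr eqxx.
Qed.

Lemma common_denominator (R : idomainType) (I : finType) (w : I -> {fraction R}) :
  exists (d : R) (r : I -> R), d != 0 /\ forall i, d%:F * w i = (r i)%:F.
Proof.
have fracE i : exists u : R * R, u.2 != 0 /\ u.2%:F * w i = u.1%:F.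
  elim/quotW: (w i) => x; exists (\n_x, \d_x); split=> /=; first exact: denom_ratioP.
  unlock FracField.tofrac; rewrite -[LHS]FracField.pi_mul; apply/eqmodP.
  rewrite /= FracField.equivfE /FracField.mulf.
  by rewrite !numden_Ratio ?mul1r ?mulr1 ?oner_eq0 ?denom_ratioP // mulrC.
have [u uE] := choice fracE.
exists (\prod_i (u i).2), (fun i => (u i).1 * \prod_(j | j != i) (u j).2).
split=> [|i]; first by apply/prodf_neq0 => i _; case: (uE i).
by rewrite (bigD1 i) //= !tofracM -(uE i).2 mulrAC.
Qed.

(** * Coordinates with respect to a generating family *)

Section Span.
Context {R : idomainType} {A : falgType {fraction R}}.
Variable b : seq A.
Let n := size b.

(** Row vectors make matrix algebra over [R] available; the coordinates of an element may fail to be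
    unique, since [b] may be linearly dependent. *)
Definition span_vec (c : 'rV[R]_n) : A := \sum_i (c 0 i)%:F *: b`_i.

Lemma lattice_spanP x : lattice_span b x <-> exists c, x = span_vec c.
Proof.
split=> -[c ->]; last by exists (fun i => c 0 i).
by exists (\row_i c i); apply: eq_bigr => i _; rewrite mxE.
Qed.

Lemma span_vecB c d : span_vec (c - d) = span_vec c - span_vec d.
Proof.
rewrite /span_vec -sumrB; apply: eq_bigr => i _.
by rewrite !mxE tofracB scalerBl.
Qed.

Lemma span_vecZ r c : span_vec (r *: c) = r%:F *: span_vec c.
Proof.
rewrite /span_vec scaler_sumr; apply: eq_bigr => i _.
by rewrite !mxE tofracM scalerA.
Qed.

Lemma span_vec_delta i : span_vec (delta_mx 0 i) = b`_i.
Proof.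
rewrite /span_vec (bigD1 i) //= big1 ?addr0 => [|j neqji].
  by rewrite mxE !eqxx tofrac1 scale1r.
by rewrite mxE (negPf neqji) andbF tofrac0 scale0r.
Qed.

Lemma span_vec_mul_mx m (v : 'I_m -> A) (C : 'M[R]_(m, n)) (c : 'rV[R]_m) :
  (forall i, v i = span_vec (row i C)) ->
  span_vec (c *m C) = \sum_i (c 0 i)%:F *: v i.
Proof.
move=> vE; transitivity (\sum_i \sum_j (c 0 i * C i j)%:F *: b`_j).
  rewrite exchange_big; apply: eq_bigr => j _.
  by rewrite mxE (raddf_sum (@FracField.tofrac R)) scaler_suml.
apply: eq_bigr => i _; rewrite vE /span_vec scaler_sumr; apply: eq_bigr => j _.
by rewrite mxE tofracM scalerA.
Qed.

Lemma span_vec_mulr (a : A) (C : 'M[R]_n) (c : 'rV[R]_n) :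
  (forall i : 'I_n, b`_i * a = span_vec (row i C)) ->
  span_vec c * a = span_vec (c *m C).
Proof.
move=> CE; rewrite (span_vec_mul_mx (v := fun i => b`_i * a)) //.
by rewrite /span_vec mulr_suml; apply: eq_bigr => i _; rewrite scalerAl.
Qed.

End Span.

Arguments span_vec {R A} b c.

(** * Scaling, radical and idempotents of an order *)

Section OrderLemmas.
Context {R : idomainType} {A : falgType {fraction R}}.
Variables (pi : R) (L : set A).
Hypotheses (dvrR : dvr pi) (orderL : is_order L).

Lemma order_subring : subring_with L 1.
Proof.
have [[b _ ->] L1 LM] := orderL; split=> //; last by move=> x; rewrite mul1r mulr1.
move=> x y /lattice_spanP[c ->] /lattice_spanP[d ->].
by apply/lattice_spanP; exists (c - d); rewrite span_vecB.
Qed.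

Lemma orderZ r x : L x -> L (r%:F *: x).
Proof.
have [[b _ ->] _ _] := orderL => /lattice_spanP[c ->].
by apply/lattice_spanP; exists (r *: c); rewrite span_vecZ.
Qed.

Lemma order_scaled (x : A) : exists2 r : R, r != 0 & L (r%:F *: x).
Proof.
have [[b spanb ->] _ _] := orderL.
have : x \in <<in_tuple b>>%VS by rewrite /= spanb memvf.
move=> /coord_span ->.
have [d [r [d0 rE]]] := common_denominator (fun i => coord (in_tuple b) i x).
exists d => //; exists r; rewrite scaler_sumr; apply: eq_bigr => i _.
by rewrite scalerA rE.
Qed.

(** Right multiplication by [a] acts on coordinates by a matrix D over [R]. As 1 - pi D is
    invertible over [R], applying its inverse to coordinates of 1 gives a left inverse of 1 - a
    pi. *)
Lemma uniformizer_jacobson : jacobson L (pi%:F *: 1).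
Proof.
have ringL := order_subring; have [L1 _ LM _] := ringL.
apply/(jacobsonP ringL); split=> [|a La]; first exact: orderZ.
have [[b _ Lb] _ _] := orderL.
have bL (i : 'I_(size b)) : L b`_i.
  by rewrite Lb; apply/lattice_spanP; exists (delta_mx 0 i); rewrite span_vec_delta.
have ba (i : 'I_(size b)) : exists c, b`_i * a = span_vec b c.
  by apply/lattice_spanP; rewrite -Lb; apply: LM.
have [C CE] := choice ba.
have [c c1] : exists c, 1 = span_vec b c by apply/lattice_spanP; rewrite -Lb.
pose D := \matrix_i C i; have unitD := det_one_sub_scale_unit D dvrR.
have Lspan d : L (span_vec b d) by rewrite Lb; apply/lattice_spanP; exists d.
exists (span_vec b (c *m invmx (1%:M - pi *: D))) => //.
rewrite (span_vec_mulr (C := 1%:M - pi *: D)); last first.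
  move=> i; rewrite mulrBr mulr1 -!scalerAr mulr1 CE.
  rewrite -span_vec_delta -span_vecZ -span_vecB; congr span_vec.
  by apply/rowP => j; rewrite !mxE eqxx eq_sym.
by rewrite mulmxKV // -c1.
Qed.

(** This finiteness statement bounds families of orthogonal idempotents. More elements than
    generators satisfy a linear relation over the fraction field; clearing denominators and dividing
    by a generator of the ideal of the coefficients makes one coefficient a unit. *)
Lemma order_relation : exists N : nat, forall x : nat -> A,
  (forall k, (k <= N)%N -> L (x k)) ->
  exists2 r : nat -> R, \sum_(k < N.+1) (r k)%:F *: x k = 0
    & exists2 k, (k <= N)%N & r k \is a GRing.unit.
Proof.
have [[b _ Lb] _ _] := orderL; exists (size b) => x Lx.
have xc (k : 'I_(size b).+1) : exists c, x k = span_vec b c.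
  by apply/lattice_spanP; rewrite -Lb; apply: Lx; rewrite -ltnS.
have [C CE] := choice xc.
pose D := \matrix_k C k.
pose DK := map_mx (@FracField.tofrac R) D.
(* [DK] has one row more than it has columns. *)
have /rowV0Pn[w kerw w0] : kermx DK != 0.
  rewrite -mxrank_eq0 mxrank_ker -lt0n subn_gt0 ltnS; exact: rank_leq_col.
have [d [r [d0 rE]]] := common_denominator (fun i => w 0 i).
have rD : (\row_i r i) *m D = 0.
  apply/matrixP => i j; rewrite [RHS]mxE; apply/eqP.
  rewrite -tofrac_eq0; apply/eqP.
  have := congr1 (fun M : 'rV_(size b) => M 0 j) (sub_kermxP kerw).
  rewrite !mxE => /(congr1 ( *%R d%:F)); rewrite mulr0 => <-.
  rewrite (raddf_sum (@FracField.tofrac R)) mulr_sumr; apply: eq_bigr => k _.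
  by rewrite !mxE /= tofracM -rE mulrA.
have [k0 rk0] : exists k, r k != 0.
  have [k wk] : exists k, w 0 k != 0.
    apply/existsP; apply: contraNT w0 => /existsPn w0.
    by apply/eqP/matrixP => i k; rewrite ord1 mxE; apply/eqP/negbNE/w0.
  by exists k; rewrite -tofrac_eq0 -rE mulf_neq0 ?tofrac_eq0.
have [princ _ _] := dvrR.
pose I := [set \sum_k s k * r k | s in [set: 'I_(size b).+1 -> R]].
have [|a Ia] := princ I.
  split=> // [|_ _ [s _ <-] [s' _ <-]|a _ _ [s _ <-]].
  - by exists (fun=> 0) => //; rewrite big1 // => k _; rewrite mul0r.
  - exists (fun k => s k - s' k) => //; rewrite -sumrB.
    by apply: eq_bigr => k _; rewrite mulrBl.
  - exists (fun k => a * s k) => //; rewrite mulr_sumr.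
    by apply: eq_bigr => k _; rewrite mulrA.
have Ir k : exists q, r k = q * a.
  have : I (r k).
    exists (fun j => (j == k)%:R) => //; rewrite (bigD1 k) //= eqxx mul1r big1 ?addr0 //.
    by move=> j /negPf ->; rewrite mul0r.
  by rewrite Ia => -[q _ <-]; exists q.
have [q qE] := choice Ir.
have a0 : a != 0 by apply: contraNneq rk0 => a0; rewrite qE a0 mulr0.
have [s _ sE] : I a by rewrite Ia; exists 1; rewrite ?mul1r.
have sq : \sum_k s k * q k = 1.
  apply: (mulIf a0); rewrite mul1r -[RHS]sE mulr_suml.
  by apply: eq_bigr => k _; rewrite qE mulrA.
exists (fun k => q (inord k)).
  have aF : a%:F != 0 by rewrite tofrac_eq0.
  apply: (scalerI aF); rewrite scaler0 scaler_sumr.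
  transitivity (span_vec b ((\row_i r i) *m D)).
    rewrite (span_vec_mul_mx (v := fun k => x k)) => [|k]; last by rewrite rowK.
    apply: eq_bigr => k _; rewrite inord_val mxE qE scalerA -tofracM.
    by rewrite [q k * a]mulrC.
  by rewrite rD /span_vec big1 // => k _; rewrite mxE tofrac0 scale0r.
(* If every q k were a multiple of [pi], the identity [sq] would make 1 a multiple of [pi]. *)
apply: contrapT => nunit; have qpi k : exists t, q k = t * pi.
  apply: contrapT => npi; apply: nunit.
  by exists k; [rewrite -ltnS|rewrite inord_val; apply: (dvr_unit dvrR)].
have [t tE] := choice qpi.
have := dvr_nonunit (\sum_k s k * t k) dvrR.
rewrite mulr_suml (eq_bigr (fun k => s k * q k)) ?sq ?eqxx // => k _.
by rewrite tE mulrA.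
Qed.

(** Multiplying the relation by the x k with unit coefficient kills the other terms modulo the
    radical. Hence that x k is in the radical, which is the bound required by
    [central_primitive_below]. *)
Lemma order_primitive_below (d : A) :
  central_idempotent_mod L (jacobson L) d -> ~ jacobson L d ->
  exists2 c, central_primitive_mod L (jacobson L) c & jacobson L (c - c * d).
Proof.
have ringL := order_subring; have JL := jacobson_two_sided ringL.
have [L1 _ _ _] := ringL; have [N relN] := order_relation.
apply: (@central_primitive_below _ _ _ _ N) => // x xid xorth.
have Lx k : (k <= N)%N -> L (x k) by move=> /xid[].
have [r rx [k lekN runit]] := relN x Lx; exists k => //.
have JZ s y : jacobson L y -> jacobson L (s%:F *: y).
  move=> Jy; have := two_sided_idealMl JL (orderZ s L1) Jy.
  by rewrite -scalerAl mul1r.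
have Jsum : jacobson L (\sum_(j < N.+1 | j != k :> nat) (r j)%:F *: (x j * x k)).
  elim/big_ind: _ => [|y z|j jk]; first exact: (two_sided_ideal0 JL).
    exact: (two_sided_idealD JL).
  by apply: JZ; apply: xorth => //; rewrite -ltnS.
have Jkk : jacobson L ((r k)%:F *: (x k * x k)).
  have := congr1 ( *%R^~ (x k)) rx; rewrite /= mul0r mulr_suml.
  under eq_bigr do rewrite -scalerAl.
  have ltkN : (k < N.+1)%N by rewrite ltnS.
  rewrite (bigD1 (Ordinal ltkN)) //= => /eqP; rewrite addr_eq0 => /eqP ->.
  exact: (two_sided_idealN JL).
have [_ xx _] := xid k lekN.
apply: (eqmod_ideal JL (eqmod_sym JL xx)).
have [r' r'r] : exists r', r' * r k = 1 by case/unitrP: runit => r' []; exists r'.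
by have := JZ r' _ Jkk; rewrite scalerA -tofracM r'r tofrac1 scale1r.
Qed.

End OrderLemmas.

(** * Trace duality, idealizers and lifted idempotents *)

Lemma reduced_traceC (K : fieldType) (A : falgType K) (tr : A -> K) a b :
  reduced_trace tr -> tr (a * b) = tr (b * a).
Proof.
move=> [L [iota [B [j [_ [m [n [phi [_ trE]]]]]]]]].
apply: (fmorph_inj iota); rewrite !trE; apply: eq_bigr => i _.
by rewrite !rmorphM /= mxtrace_mulC.
Qed.

Lemma idealizer_subring (T : pzRingType) (S I : set T) :
  two_sided_ideal S I -> subring_with (idealizer I) 1.
Proof.
move=> idI; have [[_ _ IB _] _] := idI.
split=> [|x y [xl xr] [yl yr]|x y [xl xr] [yl yr]|x _].
- by split=> x; rewrite ?mul1r ?mulr1.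
- by split=> z Iz; rewrite ?mulrBl ?mulrBr; apply: (IB); auto.
- by split=> z Iz; [rewrite -mulrA|rewrite mulrA]; auto.
- by rewrite mul1r mulr1.
Qed.

Lemma sub_idealizer (T : pzRingType) (S I : set T) :
  two_sided_ideal S I -> S `<=` idealizer I.
Proof.
move=> idI a Sa; split=> x Ix; first exact: (two_sided_idealMl idI).
exact: (two_sided_idealMr idI).
Qed.

(** For a in the idealizer, a x is again in the radical of [S], so 1 - a x has a left inverse
    already in [S]. *)
Lemma jacobson_sub_jacobson_idealizer (T : pzRingType) (S : set T) :
  subring_with S 1 -> jacobson S `<=` jacobson (idealizer (jacobson S)).
Proof.
move=> ringS x Jx; have idJ := jacobson_two_sided ringS.
apply/(jacobsonP (idealizer_subring idJ)).
have [[JS _ _ _] _] := idJ.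
split=> [|a [al ar]]; first exact: (sub_idealizer idJ (JS x Jx)).
have [S1 _ _ _] := ringS.
have [_ /(_ 1 S1)[y Sy yE]] := (jacobsonP ringS _).1 (al x Jx).
exists y; [exact: (sub_idealizer idJ)|by rewrite mul1r in yE].
Qed.

(** By self-duality it suffices that tr(z b e g f) is integral for b in [L]. It equals tr(z f b e
    g), where f b e is in the radical because f e = 0 and [e] is central modulo the radical; so f b
    e g is in the radical, hence in [L]. *)
Lemma symmetric_off_diagonal (R : idomainType) (A : falgType {fraction R})
    (L : set A) (e f : A) :
  is_order L -> symmetric_order L -> L e -> L f -> f * e = 0 ->
  (forall a, L a -> jacobson L (e * a - a * e)) ->
  peirce e (idealizer (jacobson L)) f `<=` L.
Proof.
move=> orderL [z [tr [zC _ trR Ldual]]] Le Lf fe eC _ [g [gl gr] <-].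
have ringL := order_subring orderL; have idJ := jacobson_two_sided ringL.
have [L1 _ LM _] := ringL.
rewrite Ldual => b Lb.
have Jfbe : jacobson L (f * b * e).
  have := two_sided_idealMl idJ Lf (two_sided_idealN idJ (eC b Lb)).
  by rewrite opprB mulrBr !mulrA fe mul0r subr0.
have : L (f * b * e * g) by case: idJ => -[JL _ _ _] _; apply/JL/gr.
rewrite Ldual => /(_ 1 L1)[r rE]; exists r; rewrite -rE mulr1.
rewrite !mulrA (reduced_traceC _ f trR) !mulrA; congr (tr (_ * _ * _ * _)).
by move: zC => /memv_capP[_ /centvP ->]; rewrite ?memvf.
Qed.

(** The complement d of the sum is an idempotent, central modulo the radical and orthogonal to each
    e i. If d is nonzero, a primitive c lies below it; c is congruent to some e i, so c = c d = e i
    d = 0 modulo the radical. *)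
Lemma sum_orthogonal_lifts (R : idomainType) (pi : R) (A : falgType {fraction R})
    (L : set A) h (e : 'I_h -> A) :
  dvr pi -> is_order L -> orthogonal_lifts L (jacobson L) e -> \sum_i e i = 1.
Proof.
move=> dvrR orderL [ee eorth eprim eall].
have ringL := order_subring orderL; have idJ := jacobson_two_sided ringL.
have [L1 LB LM _] := ringL.
have ecp i : central_idempotent_mod L (jacobson L) (e i) by case: (eprim i).
pose d := 1 - \sum_i e i.
have ed j : e j * d = 0.
  rewrite mulrBr mulr1 mulr_sumr (bigD1 j) //= ee big1 ?addr0 ?subrr // => i neq.
  by rewrite eorth // eq_sym.
have dd : d * d = d.
  by rewrite {1}/d mulrBl mul1r mulr_suml big1 ?subr0.
have Lsum : L (\sum_i e i).
  elim/big_ind: _ => [|x y|i _]; first exact: (subring_with0 ringL).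
    exact: (subring_withD ringL).
  by case: (ecp i).
have idd : central_idempotent_mod L (jacobson L) d.
  split=> [||a La]; first exact: LB.
    by rewrite dd subrr; apply: (two_sided_ideal0 idJ).
  rewrite mulrBl mulrBr mul1r mulr1 opprB addrC addrA subrK.
  rewrite mulr_sumr mulr_suml -sumrB.
  elim/big_ind: _ => [|x y|i _]; first exact: (two_sided_ideal0 idJ).
    exact: (two_sided_idealD idJ).
  by rewrite -opprB; apply: (two_sided_idealN idJ); case: (ecp i) => _ _; apply.
apply/eqP; rewrite eq_sym -subr_eq0; apply/eqP; rewrite -/d.
apply: contrapT => d0; have nJd : ~ jacobson L d.
  by move=> Jd; apply: d0; apply: (idempotent_jacobson ringL).
have [c cprim Jcd] := order_primitive_below dvrR orderL idd nJd.
have [i Jce] := eall c cprim; have [_ nJc _] := cprim; apply: nJc.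
apply: (eqmod_ideal idJ Jcd); rewrite -[c * d]subr0 -(ed i) -mulrBl.
by apply: (two_sided_idealMr idJ) => //; case: idd.
Qed.

(** Otherwise S is the direct sum of the nonzero ideals S c and S (1 - c). *)
Lemma indecomposable_central_idempotent (T : pzRingType) (S : set T) (c : T) :
  subring_with S 1 -> indecomposable S -> S c -> c * c = c ->
  (forall x, c * x = x * c) -> c = 0 \/ c = 1.
Proof.
move=> ringS indec Sc cc cC; have [S1 SB SM Sid] := ringS.
have S0 := subring_with0 ringS.
have [->|c0] := pselect (c = 0); first by left.
have [->|c1] := pselect (c = 1); first by right.
have ideal d : S d -> (forall x, d * x = x * d) -> two_sided_ideal S [set x * d | x in S].
  move=> Sd dC; split; first split.
  - by move=> _ [x Sx <-]; apply: SM.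
  - by exists 0; rewrite ?mul0r.
  - by move=> _ _ [x Sx <-] [y Sy <-]; exists (x - y); [apply: SB|rewrite mulrBl].
  - by move=> a _ Sa [x Sx <-]; exists (a * x); [apply: SM|rewrite mulrA].
  - move=> _ a [x Sx <-] Sa; exists (x * a); first exact: SM.
    by rewrite -!mulrA dC.
have Sc' : S (1 - c) by apply: SB.
have nz d : S d -> d <> 0 -> [set x * d | x in S] <> [set 0].
  by move=> Sd d0 E; apply: d0; have : [set 0] d by rewrite -E; exists 1; rewrite ?mul1r.
case: indec; exists [set x * c | x in S], [set x * (1 - c) | x in S]; split.
- exact: ideal.
- by apply: ideal => // x; rewrite mulrBl mulrBr cC mul1r mulr1.
- split; apply: nz => // /eqP; rewrite subr_eq0 eq_sym => /eqP; exact: c1.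
- apply/seteqP; split=> [x [[a Sa ac] [b Sb bc]]|x ->] /=; last first.
    by split; exists 0; rewrite ?mul0r.
  have xc : x * c = x by rewrite -ac -mulrA cc.
  by rewrite -xc -bc -mulrA mulrBl mul1r cc subrr mulr0.
- apply/seteqP; split=> [x Sx|_ [_ [a Sa <-] [_ [b Sb <-] <-]]].
    exists (x * c); first by exists x.
    exists (x * (1 - c)); first by exists x.
    by rewrite -mulrDr addrC subrK mulr1.
  by apply: (subring_withD ringS); apply: (SM).
Qed.

(** * Central idempotents of the algebra and the order *)

Theorem mainTheorem4 (R : idomainType) (pi : R) (A : falgType {fraction R})
    (Lambda : set A) (s h t : nat) (eps : 'I_s -> A) (e : 'I_h -> A) :
  dvr pi -> separable_algebra A ->
  is_order Lambda -> indecomposable Lambda -> ~ hereditary Lambda ->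
  symmetric_order Lambda ->
  let J := jacobson Lambda in
  let Gamma := idealizer J in
  let Delta := idealizer (jacobson Gamma) in
  let corner i (S : set A) := peirce (e i) S (e i) in
  central_primitive_idempotents eps ->
  orthogonal_lifts Lambda J e ->
  (t <= h)%N ->
  (forall i : 'I_h, (i < t)%N ->
     quotient_bimodule_iso (corner i Lambda)
       (corner i Lambda) (jacobson (corner i Lambda))
       (corner i Gamma) (jacobson (corner i Gamma))) ->
  (forall i : 'I_h, (t <= i)%N ->
     jacobson (corner i Gamma) = jacobson (corner i Lambda)) ->
  let f := \sum_(i < h | (t <= i)%N) e i in
  f = 0 ->
  hereditary Delta ->
  [/\ [/\ forall i, [set x * eps i | x in ideal_mul J J] `<=` Lambda,
          forall i, Lambda ((pi ^+ 2)%:F *: eps i)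
        & exists2 d, is_defect pi Lambda eps d & (d <= 2)%N],
      forall (i : 'I_s) (l j : 'I_h), l != j ->
        [set eps i * x | x in peirce (e l) Lambda (e j)]
          `<=` peirce (e l) Lambda (e j)
    & (1 < s)%N -> forall i, ~ ([set eps i * x | x in J] `<=` J)].
Proof.
move=> dvrR _ orderL indec _ symL J Gamma Delta corner [eps_inj epsP] lifts _.
move=> iso _ f f0 heredD.
have ringL := order_subring orderL; have [L1 LB LM _] := ringL.
have idJ : two_sided_ideal Lambda J := jacobson_two_sided ringL.
have [[JL _ _ _] _] := idJ.
have ringG : subring_with Gamma 1 := idealizer_subring idJ.
have idJG := jacobson_two_sided ringG; have [[JGG _ _ _] _] := idJG.
have ringD : subring_with Delta 1 := idealizer_subring idJG.
have sLG : Lambda `<=` Gamma := sub_idealizer idJ.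
have sGD : Gamma `<=` Delta := sub_idealizer idJG.
have sJJ : J `<=` jacobson Gamma := jacobson_sub_jacobson_idealizer ringL.
have [ee eorth eprim _] := lifts.
have Le i : Lambda (e i) by have [[]] := eprim i.
have eC i a : Lambda a -> J (e i * a - a * e i) by move: a; have [[]] := eprim i.
have epsprim i : central_primitive_mod setT [set 0] (eps i) by apply/epsP; exists i.
have epseps i : eps i * eps i = eps i.
  by have [[_ /subr0_eq]] := epsprim i.
have epsC i x : eps i * x = x * eps i.
  by have [[_ _ /(_ x I) /subr0_eq]] := epsprim i.
have epsD i : Delta (eps i).
  (* A common denominator r serves as the central cancellable element: r and r eps i both lie in
     [Lambda], hence in [Delta]. *)
  have [r r0 Lr] := order_scaled orderL (eps i).
  have rF : r%:F != 0 by rewrite tofrac_eq0.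
  apply: (@hereditary_central_idempotent _ _ (r%:F *: 1)) => // [|||x y].
  - by apply: (sGD); apply: (sLG); apply: (orderZ orderL).
  - by rewrite -scalerAl mul1r; apply: (sGD); apply: (sLG).
  - by move=> x; rewrite -scalerAl -scalerAr mul1r mulr1.
  - by rewrite -!scalerAl !mul1r => /(scalerI rF).
have JJeps i x : ideal_mul J J x -> Lambda (x * eps i).
  move=> [n [a [b [Jab ->]]]]; rewrite mulr_suml; apply: JL.
  elim/big_ind: _ => [|y z|k _]; first exact: (two_sided_ideal0 idJ).
    exact: (two_sided_idealD idJ).
  (* b k is in the radical of [Gamma], an ideal of [Delta], so b k eps i lies in [Gamma], which
     multiplies a k back into [J]. *)
  have [Ja /sJJ Jb] := Jab k; rewrite -mulrA.
  have /JGG[_] : jacobson Gamma (b k * eps i) by have [_] := epsD i; apply.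
  exact.
have pi2 i : Lambda ((pi ^+ 2)%:F *: eps i).
  have -> : (pi ^+ 2)%:F *: eps i = (pi%:F *: 1) * (pi%:F *: 1) * eps i.
    by rewrite -!scalerAl !mul1r -scalerAl mul1r scalerA -tofracM.
  apply: JJeps; exists 1%N, (fun=> pi%:F *: 1), (fun=> pi%:F *: 1).
  by rewrite big_ord1; split=> // _; split; apply: uniformizer_jacobson.
have offdiag l j : l != j -> peirce (e l) Gamma (e j) `<=` Lambda.
  move=> neq; apply: symmetric_off_diagonal => //; last exact: eC.
  by rewrite eorth // eq_sym.
split; first split=> //.
- by move=> i _ [x Jx <-]; apply: JJeps.
- pose P d := `[< forall i, Lambda ((pi ^+ d)%:F *: eps i) >].
  have exP : exists d, P d by exists 2%N; apply/asboolP.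
  have [d /asboolP dP dmin] := ex_minnP exP.
  exists d; last by apply: dmin; apply/asboolP.
  by split=> // d' d'P; apply: dmin; apply/asboolP.
- move=> i l j neq _ [_ [x Lx <-] <-].
  (* This element is in [J] because e l is central modulo [J] and orthogonal to e j. Multiplying by
     eps i keeps it in the radical of [Gamma], and [offdiag] returns it to [Lambda]. *)
  have Jx : J (e l * x * e j).
    have -> : e l * x * e j = (e l * x - x * e l) * e j.
      by rewrite mulrBl -(mulrA x) eorth // mulr0 subr0.
    by apply: (two_sided_idealMr idJ) => //; apply: eC.
  have Gx : Gamma (eps i * (e l * x * e j)).
    by apply: JGG; have [+ _] := epsD i; apply; apply: sJJ.
  have ex : e l * (eps i * (e l * x * e j)) * e j = eps i * (e l * x * e j).
    by rewrite !mulrA -(epsC i (e l)) -(mulrA (eps i)) ee -(mulrA _ (e j)) ee.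
  have Lx' : Lambda (eps i * (e l * x * e j)).
    by apply: (offdiag l j neq); exists (eps i * (e l * x * e j)).
  by exists (eps i * (e l * x * e j)).
move=> s1 i epsJ.
have Geps : Gamma (eps i).
  split=> x Jx; last rewrite -epsC; by apply: epsJ; exists x.
have eps_e l : eps i * e l = 0 \/ eps i * e l = e l.
  (* For an index l outside this range, e l = e l f = 0, although e l is not in [J]. *)
  have ltlt : (l < t)%N.
    rewrite ltnNge; apply/negP => letl.
    have [_ nJe _] := eprim l; apply: nJe.
    suff -> : e l = 0 by exact: (two_sided_ideal0 idJ).
    rewrite -(mulr0 (e l)) -f0 mulr_sumr (bigD1 l) //= ee big1 ?addr0 // => k /andP[_ neq].
    by rewrite eorth // eq_sym.
  have Ge : Gamma (e l) by apply: sLG.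
  have [_ _ GM _] := ringG.
  (* eps i e l is a central idempotent of the corner of [Gamma] at e l, whose quotient by its
     radical is that of the corner of [Lambda]. *)
  apply: (central_idempotent_trivial (peirce_subring ringL (Le l) (ee l))
    (peirce_subring ringG Ge (ee l)) _ (iso l ltlt)).
  - by move=> _ [x Lx <-]; exists x => //; apply: sLG.
  - by move=> x; apply: (corner_primitive ringL (eprim l) (ee l)).
  - by exists (eps i) => //; rewrite -epsC -mulrA ee.
  - by rewrite -mulrA (mulrA (e l)) -epsC -mulrA ee mulrA epseps.
  - move=> g Pg; have [eg ge] := peirceP (ee l) Pg.
    by rewrite -mulrA eg mulrA -epsC -mulrA ge epsC.
have Leps : Lambda (eps i).
  (* Each term of the sum of the eps i e l is 0 or e l. *)
  rewrite -[eps i]mulr1 -(sum_orthogonal_lifts dvrR orderL lifts) mulr_sumr.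
  elim/big_ind: _ => [|x y|l _]; first exact: (subring_with0 ringL).
    exact: (subring_withD ringL).
  by have [->|->] := eps_e l; [exact: (subring_with0 ringL)|].
have eps0 k : eps k <> 0 by have [_] := epsprim k.
have [|eps1] := indecomposable_central_idempotent ringL indec Leps (epseps i) (epsC i).
  exact: eps0.
have [k neqki] : exists k : 'I_s, k != i.
  case: s eps eps_inj epsP i s1 {epsprim epseps epsC epsD
    JJeps pi2 epsJ Geps eps_e Leps eps0 eps1}
    => [|[|s]] // eps _ _ i _.
  have [->|i0] := eqVneq i ord0; first by exists (lift ord0 ord0).
  by exists ord0; rewrite eq_sym.
(* Now eps i = 1 = eps k + (1 - eps k), and primitivity leaves eps k = 0 or eps k = 1 = eps i, both
   excluded. *)
have [_ _ prim] := epsprim i.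
have id1 c : c * c = c -> (forall x, c * x = x * c) -> central_idempotent_mod setT [set 0] c.
  by move=> cc cC; split=> // [|a _]; rewrite ?cc ?cC ?subrr.
have [||||/eps0 []|/eqP] := prim (eps k) (1 - eps k).
- exact: id1.
- apply: id1 => [|x]; last by rewrite mulrBl mulrBr mul1r mulr1 epsC.
  by rewrite mulrBr mulrBl mul1r mulr1 mulrBl mul1r epseps subrr subr0.
- by rewrite mulrBr mulr1 epseps /= subrr.
- by rewrite /= eps1 [eps k + _]addrC subrK subrr.
rewrite subr_eq0 -eps1 => /eqP /eps_inj ik; by rewrite ik eqxx in neqki.
Qed.
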